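(* Consider the generalized $(h,k)$-paging problem with queries of length $l$, and suppose $\frac{k}{k-h}\ge e$. Then for any randomized online caching algorithm $\mathrm{ALG}$ (with cache size $k$) there is a sequence of queries $\sigma$ such that $$\frac{\mathbb{E}[\mathrm{ALG}(\sigma)]}{\mathrm{OPT}(\sigma)}\ge l\ln\frac{k+1}{k-h+l+1}-l\ln\ln\frac{k+1}{k-h+l+1}-2l+1,$$ where $\mathrm{OPT}(\sigma)$ is the number of cache misses of the optimal offline algorithm with cache size $h$.
   Context: File-bundle caching: pages $\mathcal{O}=\{1,\dots,N\}$, with $N$ large compared to the cache sizes; at each time $t$ a query $Q_t\subset\mathcal{O}$ with $|Q_t|=l$ arrives; an algorithm with cache content $C_t$ incurs a unit cost (cache miss) if $Q_t\not\subseteq C_t$, in which case it must insert the pages of $Q_t$ into the cache by evicting some pages; no other changes are allowed. An online algorithm decides without knowing future queries; a randomized one updates the cache randomly and its cost is taken in expectation over its internal randomness. Generalized $(h,k)$-paging problem: the online algorithm uses a cache of size $k$ and is compared with the optimal offline algorithm (knowing the entire sequence in advance) using a cache of size $h\le k$.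
   Formalization: Proved for 1 ≤ l ≤ h with the added assumption (k+1)/(k-h+l+1) ≥ 6/5; without it the bound is undefined (l = h) or false (e.g. h = k = 21, l = 20, where it exceeds 23 but a 2-competitive algorithm exists). Caches start empty; h = k is allowed. *)

(* Defs.v *)
From HB Require Import structures.
From mathcomp Require Import all_boot all_order all_algebra.
From mathcomp Require Import all_classical all_reals all_analysis.

Set Implicit Arguments.
Unset Strict Implicit.
Unset Printing Implicit Defensive.

Import Order.TTheory GRing.Theory Num.Theory.

Local Open Scope classical_set_scope.

Notation cache N := {set 'I_N}.

Definition query (N l : nat) : Type := {Q : {set 'I_N} | #|Q| == l}.

Section FileBundleCaching.
Variables (N l : nat).

Definition hit (C : cache N) (Q : query N l) : bool := val Q \subset C.

(* On a hit the cache may not change; on a miss the only insertions are the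
   pages of Q, and any pages may be evicted to respect the capacity k. *)
Definition serve (k : nat) (C : cache N) (Q : query N l) (C' : cache N) : bool :=
  if hit C Q then C' == C
  else [&& val Q \subset C', C' \subset C :|: val Q & (#|C'| <= k)%N].

(* cs lists the cache contents right after each query of s; C is the content
   before the first one. *)
Fixpoint schedule (k : nat) (C : cache N) (s : seq (query N l))
    (cs : seq (cache N)) : bool :=
  match s, cs with
  | [::], [::] => true
  | Q :: s', C' :: cs' => serve k C Q C' && schedule k C' s' cs'
  | _, _ => false
  end.

Fixpoint misses (C : cache N) (s : seq (query N l)) (cs : seq (cache N)) : nat :=
  match s, cs with
  | Q :: s', C' :: cs' => (~~ hit C Q + misses C' s' cs')%N
  | _, _ => 0%N
  end.

(* All caches are initially empty. *)
Definition C0 : cache N := finset.set0.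

(* The default value size s bounds the cost of every schedule, so this is the
   true minimum as soon as a schedule exists (i.e., when l <= h). *)
Definition OPT (h : nat) (s : seq (query N l)) : nat :=
  \big[minn/size s]_(cs : (size s).-tuple (cache N) | schedule h C0 s cs)
    misses C0 s cs.

(* A deterministic online algorithm maps the queries received so far (the
   current one included) to the cache content after serving them. *)
Definition trace (A : seq (query N l) -> cache N) (s : seq (query N l)) :
    seq (cache N) :=
  [seq A (take t.+1 s) | t <- iota 0 (size s)].

Definition online (k : nat) (A : seq (query N l) -> cache N) : Prop :=
  forall s, schedule k C0 s (trace A s).

Definition cost (A : seq (query N l) -> cache N) (s : seq (query N l)) : nat :=
  misses C0 s (trace A s).

End FileBundleCaching.

(* The internal randomness is a point w of a probability space on T: each w
   determines a deterministic online algorithm, and the cache content after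
   each history is a random variable. *)
Record rand_alg (d : measure_display) (T : measurableType d) (N l k : nat) :=
  RandAlg {
    rand_fun :> T -> seq (query N l) -> cache N;
    rand_online : forall w, online k (rand_fun w);
    rand_measurable : forall s (C : cache N),
      measurable [set w | rand_fun w s = C]
  }.

Definition expected_cost (R : realType) (d : measure_display)
    (T : measurableType d) (P : probability T R) (N l k : nat)
    (ALG : rand_alg T N l k) (s : seq (query N l)) : R :=
  fine ('E_P[fun w => (cost (ALG w) s)%:R%R])%E.

(* Main.v *)
(* A phase starts with a set B of h pages that the offline cache contains. It
   opens with g queries of l pages each, disjoint from B and from each other,
   and then requests h - g l pages of B one at a time, each within a query
   padded with pages already requested in the phase. Offline, one keeps exactly
   the h pages requested during the phase and pays only for the g opening
   queries. An online cache of size k always misses at least h + g l - k of the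
   h + g l pages in play. Before each request we sweep through the pages already
   requested in the phase until the algorithm either has paid a lot or holds all
   of them, in which case the missing pages are among the m pages of B not yet
   requested; so some such page is missed with probability at least
   (h + g l - k) / m. Summing over m = h, ..., g l + 1 gives at least
   (h + g l - k) ln ((h + 1) / (g l + 1)) per phase, and g l close to
   (k - h + l + 1) ln X with X = (k + 1) / (k - h + l + 1) makes the ratio per
   phase strictly larger than the bound, which absorbs the start-up cost after
   many phases. If ln X <= 3 the bound is at most 1 and one query suffices. *)

Require Import Defs.
From HB Require Import structures.
From mathcomp Require Import all_boot all_order all_algebra.
From mathcomp Require Import zify ring lra.

Set Implicit Arguments.
Unset Strict Implicit.
Unset Printing Implicit Defensive.

(** * Building queries from sets of pages *)

Section Queries.
Variables N l : nat.
Implicit Types (A B C : cache N) (Q : query N l) (s q : seq (query N l)).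

Lemma exists_query A B : A \subset B -> #|A| <= l <= #|B| ->
  exists Q, A \subset val Q /\ val Q \subset B.
Proof.
move=> sAB /andP[leAl lelB].
have [m] := ubnP (l - #|A|); elim: m A sAB leAl => // m IH A sAB leAl ltm.
case: (ltngtP #|A| l) leAl => // [ltAl _|/eqP eqAl _]; last first.
  by exists (exist _ A eqAl).
have /subsetPn[x xB xA] : ~~ (B \subset A).
  by apply: contraL lelB => /subset_leq_card leBA; rewrite -ltnNge; lia.
have cardxA : #|x |: A| = #|A|.+1 by rewrite cardsU1 xA.
have [|||Q [sxAQ sQB]] := IH (x |: A); rewrite ?cardxA //.
- by rewrite subUset sub1set xB.
- lia.
by exists Q; split=> //; apply: subset_trans sxAQ; apply: subsetUr.
Qed.

(** A cache that hits all of these queries contains [B] once [0 < l <= #|B|], so a sweep through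
    them stands for requesting every page of [B]. *)
Definition queries_in B : seq (query N l) :=
  [seq Q : query N l <- enum {: query N l} | val Q \subset B].

Lemma mem_queries_in B Q : (Q \in queries_in B) = (val Q \subset B).
Proof. by rewrite mem_filter mem_enum andbT. Qed.

(** [W] is the union of the queries in [q]; the last clause says so in the form needed for caches:
    hitting all of [q] means holding [W]. *)
Lemma fresh_queries B g : #|B| + g * l <= N ->
  exists q (W : cache N), [/\ size q = g, #|W| = g * l, [disjoint W & B],
    all (fun Q : query N l => val Q \subset W) q &
    forall C, all (fun Q : query N l => val Q \subset C) q -> W \subset C].
Proof.
elim: g => [|g IH] leN.
  by exists [::], set0; rewrite cards0 disjoints_subset sub0set; split=> // C _;
    rewrite sub0set.
have [|q [W [szq cW dWB qW Wq]]] := IH; first by lia.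
have cWB : #|W :|: B| = g * l + #|B|.
  by move: dWB; rewrite -setI_eq0 -cW cardsU => /eqP->; rewrite cards0 subn0.
have [||Q [_ sQ]] := @exists_query set0 (~: (W :|: B)).
- by rewrite sub0set.
- by rewrite cards0 /= cardsCs setCK cWB card_ord; lia.
move: sQ; rewrite setCU subsetI -!disjoints_subset => /andP[dQW dQB].
exists (Q :: q), (val Q :|: W); split=> /=.
- by rewrite szq.
- move: dQW; rewrite -setI_eq0 cardsU => /eqP->.
  by rewrite cards0 subn0 cW (eqP (valP Q)) mulSn.
- by rewrite -setI_eq0 setIUl setU_eq0 !setI_eq0 dQB dWB.
- rewrite subsetUl /=; apply: sub_all qW => Q'.
  by move/subset_trans; apply; apply: subsetUr.
- by move=> C /andP[sQC /Wq sWC]; rewrite subUset sQC.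
Qed.

Hypothesis l_gt0 : 0 < l.

Lemma query_through x B : x \in B -> l <= #|B| ->
  exists Q, x \in val Q /\ val Q \subset B.
Proof.
move=> xB lB; have [||Q [sxQ sQB]] := @exists_query [set x] B.
- by rewrite sub1set.
- by rewrite cards1 l_gt0.
by exists Q; rewrite -sub1set.
Qed.

Lemma cover_queries_in B C : l <= #|B| ->
  (forall Q, Q \in queries_in B -> val Q \subset C) -> B \subset C.
Proof.
move=> lB sBC; apply/subsetP=> x xB.
have [Q [xQ sQB]] := query_through xB lB.
by apply: (subsetP (sBC Q _)) => //; rewrite mem_queries_in.
Qed.

End Queries.

(** * Offline schedules and bounds on the optimum *)

Section Offline.
Variables N l h : nat.
Implicit Types (A B C : cache N) (Q : query N l) (s q : seq (query N l)).

Lemma size_schedule C s cs : schedule h C s cs -> size cs = size s.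
Proof.
elim: s C cs => [|Q s IH] C [|C' cs] //= /andP[_ /IH ->] //.
Qed.

Lemma schedule_cat C s1 s2 cs1 cs2 : schedule h C s1 cs1 ->
  schedule h (last C cs1) s2 cs2 -> schedule h C (s1 ++ s2) (cs1 ++ cs2).
Proof.
by elim: s1 C cs1 => [|Q s1 IH] C [|C' cs1] //= /andP[-> /IH].
Qed.

Lemma misses_cat C s1 s2 cs1 cs2 : schedule h C s1 cs1 ->
  misses C (s1 ++ s2) (cs1 ++ cs2)
    = misses C s1 cs1 + misses (last C cs1) s2 cs2.
Proof.
by elim: s1 C cs1 => [|Q s1 IH] C [|C' cs1] //= /andP[_ /IH ->]; rewrite addnA.
Qed.

Lemma schedule_hits C s : all (hit C) s ->
  schedule h C s (nseq (size s) C) /\ misses C s (nseq (size s) C) = 0.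
Proof.
elim: s => //= Q s IH /andP[hitQ /IH[schs ms]].
by rewrite /serve hitQ eqxx ms.
Qed.

(* On each miss evict every page outside of B. *)
Lemma schedule_into B C s :
  #|B| <= h -> all (fun Q : query N l => val Q \subset B) s ->
  exists cs, [/\ schedule h C s cs, misses C s cs <= size s,
    C :&: B \subset last C cs & all (hit (last C cs)) s].
Proof.
move=> leBh; elim: s C => [|Q s IH] C /=; first by exists [::]; rewrite subsetIl.
move=> /andP[sQB sB].
pose C' := if hit C Q then C else (C :&: B) :|: val Q.
have [cs [schs mis sub hits]] := IH C' sB; exists (C' :: cs); split=> /=.
- rewrite schs andbT /serve /C'; case: (hit C Q); first exact: eqxx.
  rewrite subsetUr setSU ?subsetIl //=; apply: leq_trans leBh.
  by apply: subset_leq_card; rewrite subUset subsetIr.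
- by case: hit => //=; lia.
- apply: subset_trans sub; rewrite subsetI subsetIr andbT /C'.
  by case: ifP; rewrite ?subsetIl // => _; apply: subsetUl.
- rewrite hits andbT; apply: subset_trans sub; rewrite subsetI sQB andbT /C'.
  by case: ifP => // _; apply: subsetUr.
Qed.

(** An invariant that avoids the exact optimum: misses are bounded only from above and the final
    cache only from below, so phases can be chained. *)
Definition reachable s v B := exists cs,
  [/\ schedule h (C0 N) s cs, misses (C0 N) s cs <= v
    & B \subset last (C0 N) cs].

Lemma reachable_start B : 0 < l <= #|B| -> #|B| = h ->
  reachable (queries_in l B) (size (queries_in l B)) B.
Proof.
move=> /andP[l_gt0 lB] cB.
have [||cs [schs mis _ /allP hits]] := @schedule_into B (C0 N) (queries_in l B).
- by rewrite cB.
- by apply/allP=> Q; rewrite mem_queries_in.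
by exists cs; split=> //; apply: (cover_queries_in l_gt0).
Qed.

(** Evicting only pages outside [B'] during [q1], the cache keeps [B :&: B'] and ends up holding
    [W], hence all of [B']; so [q2] costs nothing. *)
Lemma reachable_phase s v B W B' q1 q2 :
  reachable s v B -> #|B'| = h -> B' \subset W :|: B ->
  (forall C, all (fun Q : query N l => val Q \subset C) q1 -> W \subset C) ->
  all (fun Q : query N l => val Q \subset B') (q1 ++ q2) ->
  reachable (s ++ q1 ++ q2) (v + size q1) B'.
Proof.
move=> [cs [schs mis sB]] cB' sB' covW; rewrite all_cat => /andP[q1B' q2B'].
have [|cs1 [sch1 mis1 sub1 hit1]] := schedule_into (last (C0 N) cs) _ q1B'.
  by rewrite cB'.
have sB'1 : B' \subset last (last (C0 N) cs) cs1.
  apply/subsetP=> x xB'; case/setUP: (subsetP sB' _ xB') => [xW|xB].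
    exact: (subsetP (covW _ hit1)).
  by apply: (subsetP sub1); rewrite inE xB' (subsetP sB).
have [|sch2 mis2] := @schedule_hits (last (last (C0 N) cs) cs1) q2.
  by apply: sub_all q2B' => Q sQ; apply: subset_trans sB'1.
exists (cs ++ cs1 ++ nseq (size q2) (last (last (C0 N) cs) cs1)); split.
- by do 2?[apply: schedule_cat => //].
- rewrite (misses_cat _ _ schs) (misses_cat _ _ sch1) mis2; lia.
- rewrite !last_cat; case: (size q2) => //= n.
  by rewrite (_ : last _ (nseq n _) = last (last (C0 N) cs) cs1) //; elim: n.
Qed.

Lemma OPT_le s v B : reachable s v B -> OPT h s <= v.
Proof.
move=> [cs [schs mis _]]; apply: leq_trans mis.
have/eqP szcs := size_schedule schs.
rewrite /OPT -minEnat -leEnat.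
exact: (@Order.TotalTheory.bigmin_le_cond _ _ _ _ (Tuple szcs) _
  (fun t => misses (C0 N) s (tval t))).
Qed.

Lemma OPT_le_size s : OPT h s <= size s.
Proof. by rewrite /OPT -minEnat -leEnat; apply: Order.TotalTheory.bigmin_le_id. Qed.

Lemma miss_C0 Q : 0 < l -> ~~ hit (C0 N) Q.
Proof. by move=> l_gt0; rewrite /hit subset0 -cards_eq0 (eqP (valP Q)) -lt0n. Qed.

(** The cache starts empty, so every schedule misses the first query; the default value [size s] of
    the minimum is positive as well. *)
Lemma OPT_gt0 s : 0 < l -> s != [::] -> 0 < OPT h s.
Proof.
move=> l_gt0 s_neq0; rewrite /OPT.
apply: (big_ind (fun m => 0 < m)) => [|m n|[cs szcs] /= schs].
- by case: s s_neq0.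
- by rewrite leq_min => ->.
case: s cs s_neq0 {szcs} schs => [|Q s] [|C cs] //= _ _.
by rewrite miss_C0.
Qed.

End Offline.

(** * Cost of a deterministic online algorithm *)

Section Online.
Variables N l k : nat.
Variable A : seq (query N l) -> cache N.
Hypothesis onA : online k A.
Implicit Types (B C : cache N) (Q : query N l) (s q : seq (query N l)).

Definition cache_after s : cache N := last (C0 N) (trace A s).

Lemma trace_rcons s Q : trace A (rcons s Q) = rcons (trace A s) (A (rcons s Q)).
Proof.
rewrite /trace size_rcons -addn1 iotaD map_cat /= add0n cats1.
congr rcons; last by rewrite -(size_rcons s Q) take_size.
apply/eq_in_map => t; rewrite mem_iota add0n => /andP[_ lt_t].
by rewrite -cats1 takel_cat.
Qed.

Lemma cache_after_rcons s Q : cache_after (rcons s Q) = A (rcons s Q).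
Proof. by rewrite /cache_after trace_rcons last_rcons. Qed.

Lemma size_trace s : size (trace A s) = size s.
Proof. by rewrite size_map size_iota. Qed.

Lemma cost_rcons s Q :
  cost A (rcons s Q) = cost A s + ~~ hit (cache_after s) Q.
Proof.
by rewrite /cost trace_rcons -!cats1 (misses_cat _ _ (onA s)) /= addn0.
Qed.

Lemma serve_cache_after s Q :
  serve k (cache_after s) Q (cache_after (rcons s Q)).
Proof.
have := onA (rcons s Q); rewrite cache_after_rcons trace_rcons /cache_after.
move: (A _) (trace A s) (size_trace s) => C1 cs.
elim: s (C0 N) cs => [|Q' s IH] C [|C' cs] //=; first by rewrite andbT.
by move=> [szcs] /andP[_ /(IH _ _ szcs)].
Qed.

Lemma card_cache_after s : #|cache_after s| <= k.
Proof.
elim/last_ind: s => [|s Q IH]; first by rewrite /cache_after cards0.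
have := serve_cache_after s Q; rewrite /serve; case: ifP => [_ /eqP-> //|_].
by case/and3P.
Qed.

Lemma leq_cost_cat s q : cost A s <= cost A (s ++ q).
Proof.
elim: q s => [|Q q IH] s; first by rewrite cats0.
by rewrite -cat_rcons; apply: leq_trans (IH _); rewrite cost_rcons leq_addr.
Qed.

Lemma cache_after_hit s Q :
  hit (cache_after s) Q -> cache_after (rcons s Q) = cache_after s.
Proof. by have := serve_cache_after s Q; rewrite /serve => /[swap] -> /eqP. Qed.

Lemma cache_after_hits s q :
  all (hit (cache_after s)) q -> cache_after (s ++ q) = cache_after s.
Proof.
elim: q s => [|Q q IH] s /=; first by rewrite cats0.
by move=> /andP[/cache_after_hit eqC] hitq; rewrite -cat_rcons IH eqC.
Qed.

(** Hits leave the cache unchanged, so the first query of [q] not contained in the cache after [s]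
    is still a miss when it arrives. *)
Lemma ltn_cost_cat s q :
  ~~ all (hit (cache_after s)) q -> cost A s < cost A (s ++ q).
Proof.
elim: q s => [|Q q IH] s //=; rewrite -cat_rcons.
case hitQ: hit => /=.
  by move=> nhit; have := IH (rcons s Q); rewrite cache_after_hit // cost_rcons
    hitQ addn0; apply.
by move=> _; apply: leq_trans (leq_cost_cat _ _); rewrite cost_rcons hitQ addn1.
Qed.

Definition sweeps n q : seq (query N l) := flatten (nseq n q).

(* A sweep without a miss leaves the cache unchanged, so only sweeps costing at
   least 1 each can keep the swept pages out of the cache. *)
Lemma cost_sweeps s q n : cost A s + n <= cost A (s ++ sweeps n q) \/
  all (hit (cache_after (s ++ sweeps n q))) q.
Proof.
elim: n s => [|n IH] s; first by left; rewrite addn0 leq_cost_cat.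
rewrite /sweeps /= catA -/(sweeps n q).
case: (boolP (all (hit (cache_after s)) q)) => [hitq|nhit].
  right; rewrite cache_after_hits cache_after_hits //.
  by apply/allP=> Q /flattenP[_ /nseqP[-> _]]; apply: (allP hitq).
have lt := ltn_cost_cat nhit.
by case: (IH (s ++ q)) => [le|]; [left; lia | right].
Qed.

(* Either the sweeps cost at least n, or all of M is cached, and then at least
   #|U :|: M| - k pages of U are not. *)
Lemma sum_cost_requests s n (U M : cache N) (Qx : 'I_N -> query N l) :
  0 < l <= #|M| -> 0 < #|U| -> [disjoint U & M] -> n + k <= #|U| + #|M| ->
  (forall x, x \in U -> x \in val (Qx x)) ->
  #|U| * cost A s + n <=
    \sum_(x in U) cost A (rcons (s ++ sweeps n (queries_in l M)) (Qx x)).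
Proof.
move=> /andP[l_gt0 lM] U_gt0 dUM lenk inQ.
set s' := s ++ _.
have lecost : cost A s <= cost A s' by apply: leq_cost_cat.
under eq_bigr do rewrite cost_rcons.
rewrite big_split /= sum_nat_const.
case: (cost_sweeps s (queries_in l M) n) => [le|hits].
  apply: leq_trans (leq_addr _ _).
  apply: (@leq_trans (#|U| * (cost A s + n))); last by rewrite leq_mul2l le orbT.
  by rewrite mulnDr leq_add2l leq_pmull.
rewrite -/s' in hits.
have sMC : M \subset cache_after s'.
  by apply: (cover_queries_in l_gt0) => // Q; apply: (allP hits).
rewrite leq_add ?leq_mul //.
have cUM : #|U :|: M| = #|U| + #|M|.
  by move: dUM; rewrite -setI_eq0 cardsU => /eqP->; rewrite cards0 subn0.
have sUM : U :|: M \subset (U :\: cache_after s') :|: cache_after s'.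
  by apply/subsetP=> x; rewrite !inE; case xC: (x \in cache_after s') => //=;
    case/orP=> [-> //|/(subsetP sMC)]; rewrite xC.
have := subset_leq_card sUM; rewrite cUM => le1.
have le2 : #|(U :\: cache_after s') :|: cache_after s'|
    <= #|U :\: cache_after s'| + #|cache_after s'| by rewrite cardsU leq_subr.
have le3 := card_cache_after s'.
have: n <= #|U :\: cache_after s'| by lia.
move/leq_trans; apply; rewrite -sum1_card big_mkcond [leqRHS]big_mkcond /=.
apply: leq_sum => x _; rewrite inE; case xC: (x \in cache_after s') => //=.
case: ifP => // xU; rewrite lt0b; apply/negP => /subsetP/(_ x (inQ x xU)).
by rewrite xC.
Qed.

End Online.

(** * The adversary, against an abstract cost functional *)

Section Adversary.
Import GRing.Theory Num.Theory Order.TTheory.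
Local Open Scope ring_scope.
(** [F] stands for the expected cost. [F_sum_requests] is linear in [F], so it passes from
    deterministic algorithms to expectations, and the adversary needs no probability. *)
Variables (R : realFieldType) (N l h k : nat) (F : seq (query N l) -> R).
Hypothesis l_gt0 : (0 < l)%N.
Hypothesis F_ge0 : forall s, 0 <= F s.
Hypothesis F_cat : forall s q, F s <= F (s ++ q).
Hypothesis F_sum_requests :
  forall s n (U M : cache N) (Qx : 'I_N -> query N l),
  (0 < l <= #|M|)%N -> (0 < #|U|)%N -> [disjoint U & M] ->
  (n + k <= #|U| + #|M|)%N -> (forall x, x \in U -> x \in val (Qx x)) ->
  #|U|%:R * F s + n%:R <=
    \sum_(x in U) F (rcons (s ++ sweeps n (queries_in l M)) (Qx x)).

(** Averaging: some [x] in [U] does at least as well as the mean. The last query goes through [x]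
    and is padded from [M], which is possible as [l <= #|M|]. *)
Lemma exists_costly_request s n (U M : cache N) :
  (l <= #|M|)%N -> (0 < #|U|)%N -> [disjoint U & M] ->
  (n + k <= #|U| + #|M|)%N ->
  exists x q, [/\ x \in U, all (fun Q : query N l => val Q \subset x |: M) q
    & F s + n%:R / #|U|%:R <= F (s ++ q)].
Proof.
move=> lM U_gt0 dUM lenk.
have [x0 x0U] : exists x, x \in U by apply/set0Pn; rewrite -card_gt0.
have exQ x : exists Q : query N l, (x \in val Q) && (val Q \subset x |: M).
  have [||Q [xQ sQ]] := @query_through N l l_gt0 x (x |: M).
  - exact: setU11.
  - by apply: leq_trans lM _; rewrite subset_leq_card ?subsetUr.
  by exists Q; apply/andP.
pose Qx x := xchoose (exQ x).
have QxP x : (x \in val (Qx x)) && (val (Qx x) \subset x |: M).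
  exact: (xchooseP (exQ x)).
have le_sum := @F_sum_requests s n U M Qx.
have [x xU le_x] : exists2 x, x \in U & F s + n%:R / #|U|%:R <=
    F (rcons (s ++ sweeps n (queries_in l M)) (Qx x)).
  apply/exists_inP; apply: contraT => /exists_inPn lt_x.
  have: \sum_(x in U) F (rcons (s ++ sweeps n (queries_in l M)) (Qx x))
     < \sum_(x in U) (F s + n%:R / #|U|%:R).
    apply: ltr_sum => [|x /lt_x]; last by rewrite -ltNge.
    by apply/hasP; exists x0; rewrite ?mem_index_enum.
  rewrite sumr_const -[ltRHS]mulr_natl mulrDr mulrCA divff ?pnatr_eq0 -?lt0n // mulr1.
  rewrite ltNge le_sum ?l_gt0 // => x _; first by case/andP: (QxP x).
exists x, (rcons (sweeps n (queries_in l M)) (Qx x)); split=> //.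
  rewrite all_rcons; case/andP: (QxP x) => _ -> /=.
  apply/allP=> Q /flattenP[_ /nseqP[-> _]]; rewrite mem_queries_in.
  by move/subset_trans; apply; apply: subsetUr.
by rewrite -rcons_cat.
Qed.

(** Each request moves a page from [U] to [M]. This preserves [#|U| + #|M|], so the same [n] stays
    admissible, while the shrinking [#|U|] produces the harmonic denominators. *)
Lemma costly_requests j s n (U M : cache N) :
  (l <= #|M|)%N -> [disjoint U & M] -> (n + k <= #|U| + #|M|)%N ->
  (j <= #|U|)%N ->
  exists q (B : cache N), [/\ M \subset B, B \subset M :|: U,
    #|B| = (#|M| + j)%N, all (fun Q : query N l => val Q \subset B) q
    & F s + \sum_(i < j) n%:R / (#|U| - i)%:R <= F (s ++ q)].
Proof.
elim: j s U M => [|j IH] s U M lM dUM lenk leU.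
  exists [::], M; rewrite subsetUl addn0 big_ord0 addr0 cats0.
  by split.
have U_gt0 : (0 < #|U|)%N by lia.
have [x [q1 [xU q1M le1]]] := exists_costly_request s lM U_gt0 dUM lenk.
have xM : x \notin M by rewrite (disjointFr dUM xU).
have cU : #|U| = (#|U :\ x|).+1 by rewrite (cardsD1 x) xU.
have cM : #|x |: M| = (#|M|).+1 by rewrite cardsU1 xM.
have [||||q2 [B [sMB sBU cB q2B le2]]] := IH (s ++ q1) (U :\ x) (x |: M).
- by rewrite cM; lia.
- rewrite -setI_eq0; apply/eqP/setP=> y; rewrite !inE.
  case: eqVneq => //= _; case yU: (y \in U) => //=.
  exact: (disjointFr dUM yU).
- by rewrite cM; lia.
- by lia.
move: sMB; rewrite subUset sub1set => /andP[xB sMB].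
exists (q1 ++ q2), B; split=> //.
- apply: subset_trans sBU _; apply/subsetP=> y; rewrite !inE.
  by case: eqVneq => [->|_] /=; rewrite ?xU ?orbT.
- by rewrite cB cM addSnnS.
- rewrite all_cat q2B andbT; apply: sub_all q1M => Q /subset_trans; apply.
  by rewrite subUset sub1set xB.
rewrite catA; apply: le_trans le2; rewrite big_ord_recl /= subn0 addrA lerD //.
by rewrite le_eqVlt; apply/orP; left; apply/eqP/eq_bigr=> i _; rewrite cU.
Qed.

Lemma exists_phase s v n g (B : cache N) : #|B| = h -> reachable h s v B ->
  (0 < g)%N -> (g * l <= h)%N -> (h + g * l <= N)%N -> (n + k <= h + g * l)%N ->
  exists q (B' : cache N), [/\ #|B'| = h, reachable h (s ++ q) (v + g) B'
    & F s + \sum_(i < h - g * l) n%:R / (h - i)%:R <= F (s ++ q)].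
Proof.
move=> cB rB g_gt0 leh leN lenk.
have [|q1 [W [szq1 cW dWB q1W covW]]] := @fresh_queries N l B g; first by rewrite cB.
(* The pages [W] of the opening queries play the part of [M], and the set [B] held offline that of
   [U]. *)
have [||||q2 [B' [sWB' sB'U cB' q2B' le2]]] :=
  @costly_requests (h - g * l) (s ++ q1) n B W.
- by rewrite cW leq_pmull.
- by rewrite disjoint_sym.
- by rewrite cB cW.
- by rewrite cB leq_subr.
exists (q1 ++ q2), B'; rewrite cB' cW subnKC //; split=> //.
  rewrite -szq1; apply: (reachable_phase rB _ sB'U covW).
    by rewrite cB' cW subnKC.
  rewrite all_cat q2B' andbT; apply: sub_all q1W => Q.
  by move/subset_trans; apply.
rewrite catA; apply: le_trans le2; rewrite cB lerD2r; exact: F_cat.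
Qed.

Lemma exists_phases n g : (l <= h)%N ->
  (0 < g)%N -> (g * l <= h)%N -> (h + g * l <= N)%N -> (n + k <= h + g * l)%N ->
  exists a, forall m, exists s (B : cache N),
    [/\ s != [::], #|B| = h, reachable h s (a + m * g) B
      & m%:R * \sum_(i < h - g * l) n%:R / (h - i)%:R <= F s].
Proof.
move=> lh g_gt0 leh leN lenk.
have [B cB] : exists B : cache N, #|B| = h.
  have /card_geqP[t [ut szt _]] : (h <= #|'I_N|)%N by rewrite card_ord; lia.
  by exists [set x in t]; rewrite cardsE (card_uniqP ut).
(* The start-up cost of loading [B] is fixed before the number [m] of phases is chosen. *)
exists (size (queries_in l B)); elim=> [|m [s [B1 [s0 cB1 r1 le1]]]].
  exists (queries_in l B), B; rewrite mul0r addn0; split=> //.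
    have [x xB] : exists x, x \in B by apply/set0Pn; rewrite -card_gt0 cB; lia.
    have [|Q [_ QB]] := query_through l_gt0 xB; first by rewrite cB.
    by apply/eqP => q0; move: QB; rewrite -mem_queries_in q0.
  by apply: reachable_start => //; rewrite l_gt0 cB.
have [q [B2 [cB2 r2 le2]]] := exists_phase cB1 r1 g_gt0 leh leN lenk.
exists (s ++ q), B2; split=> //.
- by case: (s) s0.
- by rewrite mulSn addnCA addnC.
by apply: le_trans le2; rewrite -natr1 mulrDl mul1r lerD2r.
Qed.

End Adversary.

From mathcomp Require Import all_classical all_reals all_analysis.
Import Order.TTheory GRing.Theory Num.Theory.
Local Open Scope ring_scope.

(** * Passing to expectations *)

Section ExpectedCost.
Variables (R : realType) (d : measure_display) (T : measurableType d).
Variables (P : probability T R) (N l k : nat) (ALG : rand_alg T N l k).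
Implicit Types (Q : query N l) (s q : seq (query N l)).

Lemma measurable_cache_after s (C : cache N) :
  measurable [set w | cache_after (ALG w) s = C]%classic.
Proof.
case: (lastP s) => [|s' Q]; last first.
  by under eq_set do rewrite cache_after_rcons; apply: rand_measurable.
rewrite [X in measurable X](_ : _ = [set _ | C0 N = C]%classic) //.
by have [e|ne] := pselect (C0 N = C);
  [rewrite (_ : mkset _ = setT) // | rewrite (_ : mkset _ = set0) //];
  apply/seteqP; split.
Qed.

Lemma measurable_cost s :
  measurable_fun setT (fun w => (cost (ALG w) s)%:R : R).
Proof.
elim/last_ind: s => [|s Q IH]; first exact: measurable_cst.
under eq_fun do rewrite (cost_rcons (rand_online ALG _)) natrD.
apply: measurable_realfun.measurable_funD => //.
(* Only finitely many caches miss [Q], so the miss event is a finite union of measurable events. *)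
rewrite [X in measurable_fun _ X](_ : _ =
  \1_(\bigcup_(C in [set C : cache N | ~~ hit C Q])
    [set w | cache_after (ALG w) s = C])%classic); last first.
  apply/funext => w; rewrite indicE; congr (nat_of_bool _)%:R.
  apply/idP/idP => [nhit|].
    by rewrite inE; exists (cache_after (ALG w) s).
  by rewrite inE => -[C /= nhit ->].
apply: measurable_realfun.measurable_indic; apply: fin_bigcup_measurable => // C _.
exact: measurable_cache_after.
Qed.

Lemma cost_le_size s w : (cost (ALG w) s <= size s)%N.
Proof.
elim/last_ind: s => // s Q IH.
by rewrite (cost_rcons (rand_online ALG w)) size_rcons -addn1 leq_add ?leq_b1.
Qed.

Lemma integrable_cost s :
  P.-integrable setT (EFin \o (fun w => (cost (ALG w) s)%:R)).
Proof.
apply: measurable_bounded_integrable => //.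
- by apply: le_lt_trans (probability_le1 P _) _; rewrite ?ltry.
- exact: measurable_cost.
exists (size s)%:R; split; first exact: num_real.
move=> y lty w _; rewrite /= normr_nat (le_trans _ (ltW lty)) // ler_nat.
exact: cost_le_size.
Qed.

Lemma expected_costE s : expected_cost P ALG s = \int[P]_w (cost (ALG w) s)%:R.
Proof. by rewrite /expected_cost expectation.unlock. Qed.

Lemma expected_cost_ge0 s : 0 <= expected_cost P ALG s.
Proof. by rewrite expected_costE; apply: Rintegral_ge0 => w _; rewrite ler0n. Qed.

Lemma expected_cost_cat s q :
  expected_cost P ALG s <= expected_cost P ALG (s ++ q).
Proof.
rewrite !expected_costE; apply: le_Rintegral => //; try exact: integrable_cost.
by move=> w _; rewrite ler_nat (leq_cost_cat (rand_online ALG w)).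
Qed.

Lemma expected_cost_sum (I : Type) (r : seq I) (f : I -> seq (query N l)) :
  P.-integrable setT (EFin \o (fun w => \sum_(i <- r) (cost (ALG w) (f i))%:R)) /\
  \int[P]_w (\sum_(i <- r) (cost (ALG w) (f i))%:R)
    = \sum_(i <- r) expected_cost P ALG (f i).
Proof.
elim: r => [|i r [IH1 IH2]].
  rewrite big_nil; split.
    rewrite (_ : EFin \o _ = cst 0%E); first exact: integrable0.
    by apply/funext => w /=; rewrite big_nil.
  by under eq_Rintegral do rewrite big_nil; rewrite Rintegral_cst // mul0r.
split.
  rewrite (_ : EFin \o _ = (EFin \o (fun w => (cost (ALG w) (f i))%:R)) \+
    (EFin \o (fun w => (\sum_(i <- r) (cost (ALG w) (f i))%:R)%R)))%E.
    by apply: integrableD => //; apply: integrable_cost.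
  by apply/funext => w /=; rewrite big_cons EFinD.
under eq_Rintegral do rewrite big_cons.
rewrite RintegralD //; last exact: integrable_cost.
by rewrite IH2 big_cons expected_costE.
Qed.

(** A pathwise inequality survives integration; this carries [sum_cost_requests] over to expected
    costs. *)
Lemma expected_cost_sum_ge (I : Type) (r : seq I) (f : I -> seq (query N l))
    s m n :
  (forall w, (m * cost (ALG w) s + n <= \sum_(i <- r) cost (ALG w) (f i))%N) ->
  m%:R * expected_cost P ALG s + n%:R <= \sum_(i <- r) expected_cost P ALG (f i).
Proof.
move=> le_cost; have [int_sum <-] := expected_cost_sum r f.
have intm : P.-integrable setT (EFin \o (fun w => m%:R * (cost (ALG w) s)%:R)).
  exact: (integrableZl measurableT _ (integrable_cost s)).
have intn : P.-integrable setT (EFin \o (fun=> n%:R)).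
  by apply: finite_measure_integrable_cst.
have -> : m%:R * expected_cost P ALG s + n%:R =
    \int[P]_w (m%:R * (cost (ALG w) s)%:R + n%:R).
  rewrite RintegralD // RintegralZl //; last exact: integrable_cost.
  rewrite Rintegral_cst // expected_costE.
  by rewrite (congr1 fine (probability_setT P)) mulr1.
apply: le_Rintegral => //.
  exact: (integrableD measurableT intm intn).
by move=> w _; rewrite -natrM -natrD -natr_sum ler_nat.
Qed.

End ExpectedCost.

(** * Numerical estimates for exponentials, logarithms and harmonic sums *)

Section Estimates.
Variable R : realType.
Implicit Types x y : R.

(** This is [ln (1 + u) <= u] at [u = x^-1 - 1]. *)
Lemma ln_ge_oneBinv x : 0 < x -> 1 - x^-1 <= ln x.
Proof.
move=> x_gt0; have := @le_ln1Dx R (x^-1 - 1).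
rewrite addrCA subrr addr0 lnV ?posrE // => le.
have: 0 < x^-1 by rewrite invr_gt0.
by move=> ?; have := le ltac:(lra); lra.
Qed.

(** The bound [1 + x <= exp x] at [x = -1/6] gives [exp (-1) >= (5/6)^6 >= 1/3]. *)
Lemma expR1_le3 : expR 1 <= 3 :> R.
Proof.
have le56 : 5 / 6 <= expR (- (1 / 6)) :> R.
  by apply: le_trans (expR_ge1Dx _); lra.
have : (5 / 6) ^+ 6 <= expR (- (1 / 6)) ^+ 6 :> R by rewrite lerXn2r ?nnegrE //; lra.
rewrite -expRM_natr (_ : - (1 / 6) * 6%:R = -1); last by field.
rewrite expRN => le.
have e_gt0 := expR_gt0 (1 : R).
rewrite -[leRHS]invrK -[leLHS]invrK lef_pV2 ?posrE ?invr_gt0 //.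
by apply: le_trans le; lra.
Qed.

Lemma sq_expR_ge (a b x : R) :
  0 <= a -> a <= expR x -> b <= a ^+ 2 -> b <= expR (2 * x).
Proof.
move=> a_ge0 le_a le_b; apply: le_trans le_b _.
by rewrite mulrC mulr_natr mulr2n expRD -expr2 lerXn2r ?nnegrE ?expR_ge0.
Qed.

(* Six squarings, rounded down, starting from 1 + x <= exp x at x = 11 / 384. *)
Lemma expR_11_6_ge6 : 6 <= expR (11 / 6) :> R.
Proof.
have e0 : 36 / 35 <= expR (11 / 384) :> R.
  by apply: le_trans (expR_ge1Dx _); lra.
have e1 : 55 / 52 <= expR (2 * (11 / 384)) :> R by apply: sq_expR_ge e0 _; lra.
have e2 : 66 / 59 <= expR (2 * (2 * (11 / 384))) :> R.
  by apply: sq_expR_ge e1 _; lra.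
have e3 : 234 / 187 <= expR (2 * (2 * (2 * (11 / 384)))) :> R.
  by apply: sq_expR_ge e2 _; lra.
have e4 : 36 / 23 <= expR (2 * (2 * (2 * (2 * (11 / 384))))) :> R.
  by apply: sq_expR_ge e3 _; lra.
have e5 : 267 / 109 <= expR (2 * (2 * (2 * (2 * (2 * (11 / 384)))))) :> R.
  by apply: sq_expR_ge e4 _; lra.
have e6 : 6 <= expR (2 * (2 * (2 * (2 * (2 * (2 * (11 / 384))))))) :> R.
  by apply: sq_expR_ge e5 _; lra.
by rewrite (_ : 11 / 6 = 2 * (2 * (2 * (2 * (2 * (2 * (11 / 384)))))) :> R) //; lra.
Qed.

(* Convexity of exp: the tangent at y - 2 lies below exp at -11/6 and at 1. *)
Lemma expR_sub2_le y : 1 / 6 <= y <= 3 -> expR (y - 2) <= y.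
Proof.
move=> /andP[y_ge y_le].
set E := expR (y - 2); have E_gt0 : 0 < E by apply: expR_gt0.
have tangent (z : R) : E * (1 + (z - (y - 2))) <= expR z.
  rewrite -[leRHS](_ : E * expR (z - (y - 2)) = _).
    by rewrite ler_wpM2l ?expR_ge1Dx // ltW.
  by rewrite -expRD; congr expR; lra.
have le1 := tangent 1; have le2 := tangent (- (11 / 6)).
have e1 := expR1_le3.
have e2 : expR (- (11 / 6)) <= 1 / 6 :> R.
  rewrite expRN mul1r lef_pV2 ?posrE ?expR_gt0 //; exact: expR_11_6_ge6.
have {e1} le1 : E * (1 + (1 - (y - 2))) <= 3 by apply: le_trans le1 _.
have {e2} le2 : E * (1 + (- (11 / 6) - (y - 2))) <= 1 / 6 by apply: le_trans le2 _.
nra.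
Qed.

(** The target ratio is [l * (y - ln y - 2) + 1], so this makes it at most 1 for small [y]. *)
Lemma sub_ln_le2 y : 1 / 6 <= y <= 3 -> y - ln y <= 2.
Proof.
move=> y_itv; have y_gt0 : 0 < y by case/andP: y_itv => *; lra.
have := expR_sub2_le y_itv.
rewrite -[leRHS](@lnK R y) ?posrE // ler_expR; lra.
Qed.

(** Telescoping: each summand [1 / j] is at least [ln ((j + 1) / j)]. *)
Lemma ln_le_sum_inv (c h : nat) : (c <= h)%N ->
  ln ((h + 1)%:R / (c + 1)%:R) <= \sum_(i < h - c) ((h - i)%:R)^-1 :> R.
Proof.
move=> /subnK; move: (h - c)%N => j <-.
elim: j => [|j IH].
  by rewrite big_ord0 add0n divff ?ln1 // pnatr_eq0 addn1.
rewrite big_ord_recl subn0 addSn.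
under eq_bigr do rewrite subSS.
have -> : ((j + c).+1 + 1)%:R / (c + 1)%:R =
   (1 + ((j + c).+1)%:R^-1) * ((j + c + 1)%:R / (c + 1)%:R) :> R.
  rewrite !natrD -!natr1 !natrD.
  have ? : 0 <= j%:R :> R by []. have ? : 0 <= c%:R :> R by [].
  by field; apply/andP; split; apply: lt0r_neq0; lra.
have gt1 : 0 < ((j + c).+1)%:R^-1 :> R by rewrite invr_gt0 ltr0n.
have gt2 : 0 < (j + c + 1)%:R / (c + 1)%:R :> R.
  by rewrite divr_gt0 // ltr0n addn1.
rewrite lnM ?posrE ?addr_gt0 //; apply: lerD => //.
by apply: le_ln1Dx; apply: lt_trans gt1; lra.
Qed.

(* [g l] is the largest multiple of [l] below [y * (d + l + 1) - 1], where
   [y = ln X]; this nearly maximises [(1 - d / c) * ln (h / c)] over [c]. *)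
Lemma exists_fresh_count (h k l : nat) :
  (0 < l)%N -> (l <= h)%N -> (h <= k)%N ->
  let y := ln ((k + 1)%:R / (k - h + l + 1)%:R) : R in
  3 <= y ->
  exists g : nat, [/\ (0 < g)%N, (g * l <= h)%N, (k <= h + g * l)%N &
    g%:R * (l%:R * (y - ln y - 2) + 1) <
    (h + g * l - k)%:R * \sum_(i < h - g * l) ((h - i)%:R)^-1].
Proof.
move=> l_gt0 lh hk y y_ge3.
set D : R := (k - h + l + 1)%:R.
have D_gt0 : 0 < D by rewrite ltr0n addn1.
have X_gt0 : 0 < (k + 1)%:R / D by rewrite divr_gt0 ?ltr0n ?addn1.
have expy : expR y = (k + 1)%:R / D by rewrite lnK ?posrE.
have gty : 1 + y < expR y by apply: expR_gt1Dx; rewrite gt_eqF //; lra.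
have kE : k%:R + 1 = expR y * D by rewrite expy mulfVK ?gt_eqF // natrD.
have l_gt0R : 1 <= l%:R :> R by rewrite ler1n.
pose dd : R := (k - h)%:R.
have dd_ge0 : 0 <= dd by [].
have DE : D = dd + l%:R + 1 by rewrite /D !natrD.
have hE : h%:R = k%:R - dd by rewrite /dd natrB // subKr.
pose z := (D * y - 1) / l%:R.
have z_ge0 : 0 <= z by apply: divr_ge0 => //; nra.
(* Truncation gives [D * y - 1 - l < g * l <= D * y - 1]. *)
pose g := Num.truncn z.
have /andP[gz zg] := truncn_itv z_ge0; rewrite -/g in gz zg.
rewrite ler_pdivlMr in gz; last lra.
rewrite ltr_pdivrMr in zg; last lra.
rewrite -natr1 in zg.
pose c : R := (g * l)%:R.
have cE : c = g%:R * l%:R by rewrite /c natrM.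
rewrite -cE in gz; rewrite mulrDl mul1r -cE in zg.
have c_gt : dd * y < c by rewrite DE in zg; nra.
have c_lt : c + 1 <= D * y by lra.
have c_gt0 : 0 < c by apply: le_lt_trans c_gt; nra.
have dc : dd <= c by nra.
have g_gt0 : (0 < g)%N.
  by rewrite lt0n; apply: contraTneq c_gt0 => g0; rewrite cE g0 mul0r ltxx.
(* Here [h + 1 = expR y * D - dd > D * y], because [expR y > 1 + y] and [dd <= D]. *)
have glh : (g * l <= h)%N.
  rewrite -(ler_nat R) -/c hE; nra.
have kgl : (k <= h + g * l)%N.
  rewrite -(ler_nat R) natrD -/c hE; lra.
exists g; split=> //.
have -> : (h + g * l - k)%:R = c - dd.
  rewrite natrB // natrD -/c hE; lra.
have lny_ge1 : 1 <= ln y.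
  rewrite -[leLHS](@expRK R) ler_ln ?posrE ?expR_gt0 //; last lra.
  by apply: le_trans expR1_le3 _.
have lny_le : ln y <= y - 1.
  by have := @le_ln1Dx R (y - 1); rewrite addrCA subrr addr0; apply; lra.
(* [e] is the loss from having [h + 1 >= (expR y - 1) * D] where [k + 1 = expR y * D]: indeed
   [ln (expR y - 1) >= y - e]. *)
pose e := (expR y - 1)^-1.
have e_lt : e < y^-1 by rewrite ltf_pV2 ?posrE; lra.
have e_gt0 : 0 < e by rewrite invr_gt0; lra.
have ye : e * y < 1 by rewrite -[ltRHS](@mulVf R y) ?ltr_pM2r ?gt_eqF //; lra.
pose L := ln ((h + 1)%:R / (g * l + 1)%:R) : R.
have L_ge : y - e - ln y <= L.
  have: ln ((expR y - 1) / y) <= L.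
    rewrite ler_ln ?posrE ?divr_gt0 ?ltr0n ?addn1 //; try lra.
    rewrite -!natr1 -/c hE ler_pdivlMr; last lra.
    rewrite mulrAC ler_pdivrMr; last lra.
    nra.
  apply: le_trans; rewrite ln_div ?posrE; try lra.
  rewrite lerD2r.
  have -> : expR y - 1 = expR y * (1 - expR (- y)).
    by rewrite mulrBr mulr1 -expRD subrr expR0.
  have em : expR (- y) < 1 by rewrite expR_lt1; lra.
  rewrite lnM ?posrE ?expR_gt0 ?expRK ?lerD2l ?subr_gt0 //.
  apply: le_trans (ln_ge_oneBinv _); last by rewrite subr_gt0.
  rewrite /e expRN.
  have ey_gt1 : 1 < expR y by lra.
  rewrite (_ : 1 - (1 - (expR y)^-1)^-1 = - (expR y - 1)^-1) //.
  by field; rewrite !gt_eqF //; lra.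
have LS := ln_le_sum_inv glh; rewrite -/L in LS.
apply: lt_le_trans (_ : (c - dd) * L <= _); last by rewrite ler_wpM2l // subr_ge0.
have L_gt0 : 0 < L by apply: lt_le_trans L_ge; nra.
(* As [g <= c], the extra [+ 1] per opening query adds up to at most [c]. *)
apply: le_lt_trans (_ : _ <= c * (y - ln y - 1)) _.
  have -> : g%:R * (l%:R * (y - ln y - 2) + 1) = c * (y - ln y - 2) + g%:R.
    by rewrite cE; ring.
  have : g%:R <= c by rewrite cE ler_peMr.
  lra.
have : c * (1 - y^-1) <= c - dd.
  have : dd <= c * y^-1 by rewrite ler_pdivlMr ?ltW //; lra.
  lra.
move=> le_c; apply: lt_le_trans (_ : c * (1 - y^-1) * L <= _); last first.
  by rewrite ler_wpM2r // ltW.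
rewrite -mulrA ltr_pM2l //.
have yV : y * y^-1 = 1 by rewrite divff // gt_eqF //; lra.
have yV_gt0 : 0 < y^-1 by rewrite invr_gt0; lra.
have yV_lt1 : y^-1 < 1 by rewrite invf_lt1; lra.
apply: lt_le_trans (_ : (1 - y^-1) * (y - e - ln y) <= _); last first.
  by rewrite ler_wpM2l //; lra.
(* Expanded, this is [e * (1 - y^-1) < ln y * y^-1], which follows from [e < y^-1] and
   [1 <= ln y]. *)
nra.
Qed.

End Estimates.

(* The case h = k, where k / (k - h) is infinite, is allowed.  The condition
   [nondegenerate] keeps the iterated logarithm away from -oo: without it the
   lower bound fails, e.g. for h = k = 21 and l = 20, where it exceeds 23
   although a marking algorithm is 2-competitive. *)
Theorem theorem4p4 (R : realType) (h k l : nat)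
    (l_gt0 : (0 < l)%N) (l_le_h : (l <= h)%N) (h_le_k : (h <= k)%N)
    (ratio_ge_e : (h < k)%N -> expR 1 <= k%:R / (k - h)%:R :> R)
    (nondegenerate : 6%:R / 5%:R <= (k + 1)%:R / (k - h + l + 1)%:R :> R) :
  exists N0 : nat, forall N : nat, (N0 <= N)%N ->
  forall (d : measure_display) (T : measurableType d) (P : probability T R)
    (ALG : rand_alg T N l k),
  exists s : seq (query N l), (0 < OPT h s)%N /\
    expected_cost P ALG s / (OPT h s)%:R >=
      l%:R * ln ((k + 1)%:R / (k - h + l + 1)%:R)
      - l%:R * ln (ln ((k + 1)%:R / (k - h + l + 1)%:R))
      - 2%:R * l%:R + 1 :> R.
Proof.
set X : R := (k + 1)%:R / (k - h + l + 1)%:R; set y := ln X.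
rewrite -/X in nondegenerate.
(* From [X >= 6/5]: [ln X >= 1 - X^-1 >= 1/6]. *)
have y_ge : 1 / 6 <= y.
  apply: le_trans (ln_ge_oneBinv _); last by lra.
  have : X^-1 <= (6 / 5)^-1 by rewrite lef_pV2 ?posrE //; lra.
  lra.
(* A phase involves [B] and [g * l <= h] fresh pages, so [2 * h] pages suffice. *)
exists (h + h)%N => N leN d T P ALG.
have [y_le3|/ltW y_ge3] := leP y 3.
  have [B cB] : exists B : cache N, #|B| = l.
    have /card_geqP[t [ut szt _]] : (l <= #|'I_N|)%N by rewrite card_ord; lia.
    by exists [set:: t]%SET; rewrite cardsE (card_uniqP ut).
  pose Q : query N l := exist _ B (introT eqP cB).
  exists [:: Q]; have gt0 := @OPT_gt0 N l h [:: Q] l_gt0 isT; split=> //.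
  have -> : OPT h [:: Q] = 1%N by have := OPT_le_size h [:: Q]; rewrite /=; lia.
  rewrite divr1.
  have := @expected_cost_sum_ge R d T P N l k ALG unit [:: tt] (fun=> [:: Q])
    [::] 0 1; rewrite !big_seq1 mul0r add0r => le1.
  apply: (@le_trans _ _ 1); last first.
    apply: le1 => w; rewrite big_seq1 -[[:: Q]]/(rcons [::] Q).
    by rewrite (cost_rcons (rand_online ALG w)) miss_C0 // addn1.
  have := @sub_ln_le2 R y; rewrite y_ge y_le3 => /(_ isT) le2.
  have : 0 < l%:R :> R by rewrite ltr0n.
  nra.
have [g [g_gt0 glh kgl lt_g]] := exists_fresh_count l_gt0 l_le_h h_le_k y_ge3.
set n := (h + g * l - k)%N in lt_g.
rewrite -/X -/y in lt_g.
have F_sum s m (U M : cache N) (Qx : 'I_N -> query N l) :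
    (0 < l <= #|M|)%N -> (0 < #|U|)%N -> [disjoint U & M] ->
    (m + k <= #|U| + #|M|)%N -> (forall x, x \in U -> x \in val (Qx x)) ->
    #|U|%:R * expected_cost P ALG s + m%:R <= \sum_(x in U)
      expected_cost P ALG (rcons (s ++ sweeps m (queries_in l M)) (Qx x)).
  move=> lM U_gt0 dUM leUM inQ; rewrite -big_enum.
  apply: expected_cost_sum_ge => w; rewrite big_enum.
  exact: (sum_cost_requests (rand_online ALG w)).
have [||a phs] := exists_phases l_gt0 (expected_cost_ge0 P ALG)
  (expected_cost_cat P ALG) F_sum (n := n) l_le_h g_gt0 glh; try lia.
set rho := _ + 1.
have rhoE : rho = l%:R * (y - ln y - 2) + 1 by rewrite /rho; ring.
move: lt_g; rewrite -rhoE mulr_sumr -subr_gt0.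
set gain := \sum_(i < _) _ => delta_gt0.
(* Each phase exceeds the ratio [rho] by a surplus [gain - g * rho > 0]; [m + 1] phases outweigh the
   start-up term [a * rho]. *)
pose m := Num.truncn (`|a%:R * rho| / (gain - g%:R * rho)).
have [s [B [s0 _ reach le_s]]] := phs m.+1.
have gt0 := OPT_gt0 h l_gt0 s0.
exists s; split=> //.
rewrite ler_pdivlMr ?ltr0n //.
(* A nonpositive target is immediate; a nonnegative one lets [OPT] be replaced by its upper bound
   [a + (m + 1) * g]. *)
have [rho_le0|/ltW rho_ge0] := leP rho 0.
  by apply: le_trans (expected_cost_ge0 _ _ _); rewrite mulr_le0_ge0.
apply: le_trans le_s.
apply: (@le_trans _ _ (rho * (a + m.+1 * g)%:R)).
  by rewrite ler_wpM2l // ler_nat (OPT_le reach).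
have lt_m : `|a%:R * rho| < m.+1%:R * (gain - g%:R * rho).
  rewrite -ltr_pdivrMr //; have /truncn_itv/andP[] // : 0 <= `|a%:R * rho| /
    (gain - g%:R * rho) by rewrite divr_ge0 // ltW.
have {lt_m} := le_lt_trans (ler_norm _) lt_m.
rewrite natrD natrM -/gain; move: (gain) (rho) (m.+1%:R) => u v x; lra.
Qed.
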